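(* Let $r>0$ and $x_0>0$, and let $P$ be a real-valued function of $K>0$ satisfying: (i) $(K-x_0)^+\le P(K)\le K$ for all $K$; (ii) $P$ is nondecreasing and convex; (iii) there exists $K^*\in(x_0,\infty)$ such that $P(K)=K-x_0$ for $K\ge K^*$ and $P(K)>K-x_0$ for $K\in[x_0,K^* )$. Then there exists a time-homogeneous Markov process $(X_t)_{t\ge 0}$, right-continuous for $t>0$, with $X_0=x_0$, such that $$\sup_{\tau}\mathbb{E}^{x_0}\bigl[e^{-r\tau}(K-X_\tau)^+\bigr]=P(K)\qquad\text{for all }K>0,$$ where the supremum is over stopping times $\tau$, and such that $(e^{-rt}X_t)_{t\ge0}$ is a local martingale.
   Context: $y^+=\max(y,0)$, and $\mathbb{E}^{x_0}$ denotes expectation for the process with $X_0=x_0$. The process $X$ is defined on some filtered probability space and is adapted; stopping times and the local martingale property are with respect to that filtration. Stopping times may take the value $\infty$, and $e^{-r\tau}(K-X_\tau)^+$ is interpreted as $0$ on $\{\tau=\infty\}$. The paths of $X$ are right-continuous at every $t>0$ but are not required to be right-continuous at $t=0$: an immediate jump at time $0$ is allowed (subject to the martingale condition, i.e. the jump does not change the mean $x_0$). *)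

(* Defs.v *)
From HB Require Import structures.
From mathcomp Require Export all_boot all_order all_algebra.
From mathcomp Require Export all_classical all_reals all_analysis.
Export Order.TTheory GRing.Theory Num.Theory.
Export numFieldNormedType.Exports.

#[export] Set Implicit Arguments.
#[export] Unset Strict Implicit.
#[export] Unset Printing Implicit Defensive.

#[global] Open Scope classical_set_scope.
#[global] Open Scope ring_scope.

(* Time is [0, +oo[; families indexed by R (filtrations, processes, transition
   functions) are only meaningful, and only constrained, at times t >= 0. *)

Definition is_filtration d (T : measurableType d) (R : realType)
    (F : R -> set (set T)) : Prop :=
  (forall t, 0 <= t -> sigma_algebra setT (F t) /\ F t `<=` measurable) /\
  (forall s t, 0 <= s -> s <= t -> F s `<=` F t).

Definition measurable_wrt (T : Type) (R : realType) (G : set (set T))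
    (Y : T -> R) : Prop :=
  forall B : set R, measurable B -> G (Y @^-1` B).

Definition adapted (T : Type) (R : realType) (F : R -> set (set T))
    (X : R -> T -> R) : Prop :=
  forall t, 0 <= t -> measurable_wrt (F t) (X t).

Definition stopping_time (T : Type) (R : realType) (F : R -> set (set T))
    (tau : T -> \bar R) : Prop :=
  (forall w, (0 <= tau w)%E) /\
  (forall t, 0 <= t -> F t [set w | (tau w <= t%:E)%E]).

(* Z is a version of E[Y | G]. *)
Definition is_cond_exp d (T : measurableType d) (R : realType)
    (Pr : probability T R) (G : set (set T)) (Y Z : T -> R) : Prop :=
  [/\ measurable_wrt G Z,
      Pr.-integrable setT (EFin \o Z) &
      forall A, G A ->
        (\int[Pr]_(w in A) (Z w)%:E = \int[Pr]_(w in A) (Y w)%:E)%E].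

Definition martingale d (T : measurableType d) (R : realType)
    (Pr : probability T R) (F : R -> set (set T)) (M : R -> T -> R) : Prop :=
  [/\ adapted F M,
      forall t, 0 <= t -> Pr.-integrable setT (EFin \o M t) &
      forall s t, 0 <= s -> s <= t -> is_cond_exp Pr (F s) (M t) (M s)].

(* For 0 <= tau and 0 <= t the minimum is finite, so [fine] loses nothing. *)
Definition stopped (T : Type) (R : realType) (M : R -> T -> R)
    (tau : T -> \bar R) : R -> T -> R :=
  fun t w => M (fine (Order.min (tau w) t%:E)) w.

Definition local_martingale d (T : measurableType d) (R : realType)
    (Pr : probability T R) (F : R -> set (set T)) (M : R -> T -> R) : Prop :=
  adapted F M /\
  exists tau : nat -> T -> \bar R,
    [/\ forall n, stopping_time F (tau n),
        {ae Pr, forall w, nondecreasing_seq (fun n => tau n w)},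
        {ae Pr, forall w, tau n w @[n --> \oo] --> +oo%E} &
        forall n, martingale Pr F (stopped M (tau n))].

(* Time-homogeneous transition function on the real line: [Q t x A] is the
   probability of being in A a time t after being in x. No continuity in t is
   imposed at t = 0, so an immediate jump is possible although [Q 0 x] is the
   Dirac mass at x. *)
Definition transition_function (R : realType) (Q : R -> R.-pker R ~> R) : Prop :=
  (forall x (A : set R), measurable A -> Q 0 x A = \d_x A) /\
  (forall s t x (A : set R), 0 <= s -> 0 <= t -> measurable A ->
     Q (s + t) x A = (\int[Q s x]_y Q t y A)%E).

(* P(X_{s+t} \in A | F_s) = Q_t(X_s, A) almost surely. *)
Definition time_homogeneous_markov d (T : measurableType d) (R : realType)
    (Pr : probability T R) (F : R -> set (set T)) (X : R -> T -> R) : Prop :=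
  adapted F X /\
  exists Q : R -> R.-pker R ~> R,
    transition_function Q /\
    forall s t (A : set R), 0 <= s -> 0 <= t -> measurable A ->
      is_cond_exp Pr (F s) (fun w => \1_A (X (s + t) w))
                           (fun w => fine (Q t (X s w) A)).

Definition put_payoff (T : Type) (R : realType) (r K : R) (X : R -> T -> R)
    (tau : T -> \bar R) : T -> R :=
  fun w => if tau w is t%:E
           then expR (- (r * t)) * Num.max (K - X t w) 0 else 0.

(* Main.v *)
Require Import Defs.
From HB Require Import structures.
From mathcomp Require Import measurable_realfun.
From mathcomp Require Import ring lra.

(* Under the hypotheses, [P K = E (K - xi)^+] for a nonnegative random variable
   [xi] of mean [x0] whose distribution function is the right derivative of [P].
   The process jumps at time [0+] from [x0] to [xi], and afterwards it is
   nondecreasing with its discounted value a martingale. A put on a nondecreasing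
   price should be exercised at once, so the value of the put is [E (K - xi)^+].
   Growing at rate [r] from every level would bring [xi < x0] back to [x0], where
   time-homogeneity would force a new jump; so from a level [x] in ]0, x0[ the
   process stays at [x] for an exponential time and then jumps above [x0]. *)

(** All randomness sits in a pair [(x, u)]: the level [x] chosen by the initial jump, and an
    independent uniform [u] that fixes the later jump time. The price is an explicit function of
    time and of this pair, so conditioning can be done by hand: off the event of still waiting the
    future is deterministic, and on it the rescaled [u] is again uniform. The Markov and the
    martingale property thus both reduce to an identity of integrals over the waiting event. The
    price never equals [x0] at a positive time, so the kernel issued from [x0] is free to encode the
    initial jump. The information at time 0 is trivial, hence a stopping time is 0 everywhere or
    positive everywhere. At time 0 itself the price is still [x0], so exercising at once means
    exercising at a small [t > 0], and the value is reached in the limit. The affine end [K - x0] of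
    [P] is what gives [xi] total mass 1 and mean [x0]. *)

Lemma ge0_le_integral_nonmeasurable d (T : measurableType d) (R : realType)
    (m : {measure set T -> \bar R}) (f g : T -> \bar R) :
  (forall x, 0 <= f x)%E -> (forall x, f x <= g x)%E ->
  (\int[m]_x f x <= \int[m]_x g x)%E.
Proof.
move=> f0 fg; have g0 x : (0 <= g x)%E by exact: le_trans (fg x).
(* The integral of a nonnegative function is a supremum over the simple functions below it, so
   domination suffices. This serves put payoffs at stopping times, whose measurability is never
   established. *)
rewrite !ge0_integralTE//; apply: ereal_sup_le => _ [h hf <-]; exists h => //.
by move=> x; exact: le_trans (fg x).
Qed.

(** * The uniform distribution *)

(* [measurableTypeR R] and [R] have the same measurable sets but different
   displays, and [transition_function] wants kernels on [R]. *)
Section probability_on_real.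
Variable R : realType.

Definition idR : measurableTypeR R -> R := id.

Let measurable_idR : measurable_fun setT idR.
Proof. by move=> _ A mA; rewrite setTI. Qed.

HB.instance Definition _ := isMeasurableFun.Build _ _ _ _ idR measurable_idR.

Definition on_real (m : probability (measurableTypeR R) R) : probability R R :=
  distribution m idR.

Lemma ge0_integral_on_real m (f : R -> \bar R) : measurable_fun setT f ->
  (forall x, 0 <= f x)%E -> (\int[on_real m]_x f x = \int[m]_x f x)%E.
Proof. by move=> mf f0; rewrite ge0_integral_pushforward// preimage_setT. Qed.

End probability_on_real.

Definition unif (R : realType) : probability R R :=
  on_real (uniform_prob (@ltr01 R)).

Section uniform.
Variable (R : realType).
Local Notation leb := (@lebesgue_measure R).
Local Notation nu := (unif R).

(** The image of Lebesgue measure under [u / p], divided by [p], agrees with Lebesgue measure on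
    half-open intervals; uniqueness does the rest. *)
Lemma lebesgue_measure_dilation (p : R) (A : set R) : 0 < p -> measurable A ->
  leb [set u : R | A (u / p)%R] = (p%:E * leb A)%E.
Proof.
move=> p0 mA.
pose f : measurableTypeR R -> measurableTypeR R := fun u => u / p.
have mf : measurable_fun [set: measurableTypeR R] f by exact: measurable_funM.
have p'0 : 0 <= p^-1 by rewrite invr_ge0 ltW.
have -> : leb A = ((p^-1)%:E * leb [set u : R | A (u / p)%R])%E.
  apply: (@lebesgue_measure_unique _ (mscale (NngNum p'0) (pushforward leb f))) => // _ [[a b] /= _ <-].
  rewrite /mscale/= /pushforward.
  have -> : f @^-1` `]a, b]%classic = `]a * p, b * p]%classic.
    by apply/seteqP; split => u /=; rewrite !in_itv/= /f ltr_pdivlMr// ler_pdivrMr.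
  rewrite !lebesgue_measure_itv/= !lte_fin ltr_pM2r//.
  case: ifPn => ab; last by rewrite mule0.
  by rewrite -!EFinB -EFinM; congr EFin; field; rewrite gt_eqF.
by rewrite muleA -EFinM divff ?gt_eqF// mul1e.
Qed.

Lemma ge0_integral_unif (f : R -> \bar R) : measurable_fun setT f ->
  (forall x, 0 <= f x)%E ->
  (\int[nu]_x f x = \int[leb]_(x in `[0%R, 1%R]) f x)%E.
Proof.
move=> mf f0; rewrite ge0_integral_on_real// integral_uniform//.
by rewrite subr0 invr1 mul1e.
Qed.

(** The end 1 is excluded so that [u / p] in the interval forces the strict [u < p] of
    [unif_dilation]. *)
Lemma unifE (A : set R) : measurable A -> nu A = leb (A `&` `[0, 1[).
Proof.
move=> mA; transitivity (\int[nu]_x (\1_A x)%:E)%E.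
  by rewrite integral_indic// setIT.
have mA' : measurable_fun setT (EFin \o (\1_A : R -> R)).
  exact/measurable_EFinP/measurable_indic.
rewrite ge0_integral_unif//.
rewrite -integral_itv_bndo_bndc; last exact: measurable_funTS.
by rewrite integral_indic.
Qed.

(** Given [u < p], the ratio [u / p] is again uniform: this is the lack of memory of the exponential
    time, read on [u]. *)
Lemma unif_dilation (p : R) (A : set R) : 0 < p <= 1 -> measurable A ->
  nu [set u | u < p /\ A (u / p)%R] = (p%:E * nu A)%E.
Proof.
move=> /andP[p0 p1] mA.
have mA' : measurable (A `&` `[0, 1[%classic) by exact: measurableI.
rewrite !unifE//; last first.
  rewrite (_ : mkset _ = `]-oo, p[%classic `&` (fun u => u / p) @^-1` A).
    apply: measurableI => //; rewrite -[_ @^-1` _]setTI.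
    by apply: (measurable_funM (@measurable_id _ _ _) (measurable_cst p^-1)).
  by apply/seteqP; split => u /=; rewrite in_itv.
rewrite -lebesgue_measure_dilation//; congr (leb _).
apply/seteqP; split => u /=; rewrite !in_itv/= ltr_pdivrMr// ler_pdivlMr// mul0r mul1r.
  by move=> [[-> ?] /andP[-> _]].
by move=> [? /andP[-> up]]; rewrite up (lt_le_trans up).
Qed.

End uniform.

(** * A nondecreasing process with discounted martingale property *)

Section growth.
Variables (R : realType) (r x0 : R).
Hypotheses (r0 : 0 < r) (x00 : 0 < x0).
Local Notation leb := (@lebesgue_measure R).
Local Notation nu := (unif R).

(* From [0 < x < x0] the process waits an exponential time of rate [r * (x / x0)]
   and then jumps to [x + x0]: rate times jump size is [r * x], which makes the
   discounted process a martingale. For [u] uniform on [0, 1], the jump happens at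
   the time [t] with [surv t x = u], and [u `^ (x0 / x)] is the discount factor
   [expR (- (r * t))] of that time. *)
Definition surv (t x : R) : R := expR (- (r * t * (x / x0))).

(** Levels [x <= 0] are merged into 0, where the price is absorbed; from [x0] upwards it grows at
    rate [r], as it does in the last branch since the jump. *)
Definition grow (t x u : R) : R :=
  if x <= 0 then 0 else if x0 <= x then expR (r * t) * x else
  if u < surv t x then x else (x + x0) * expR (r * t) * u `^ (x0 / x).

Lemma surv_gt0 t x : 0 < surv t x. Proof. exact: expR_gt0. Qed.

Lemma survD s t x : surv (s + t) x = surv s x * surv t x.
Proof. by rewrite /surv -expRD; congr expR; ring. Qed.

Lemma surv_nincr s t x : 0 < x -> s <= t -> surv t x <= surv s x.
Proof.
by move=> x_gt0 st; rewrite ler_expR lerN2 ler_pM2r ?divr_gt0// ler_pM2l.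
Qed.

Lemma surv_le1 t x : 0 < x -> 0 <= t -> surv t x <= 1.
Proof.
move=> x_gt0 t0; rewrite -expR0 ler_expR oppr_le0.
by rewrite mulr_ge0 ?divr_ge0 ?mulr_ge0// ltW.
Qed.

Lemma surv_powR t x : 0 < x -> surv t x `^ (x0 / x) = expR (- (r * t)).
Proof.
move=> x_gt0; rewrite /surv -expRM.
by congr expR; field; rewrite !gt_eqF.
Qed.

Lemma grow_np t x u : x <= 0 -> grow t x u = 0.
Proof. by rewrite /grow => ->. Qed.

Lemma grow_above t x u : x0 <= x -> grow t x u = expR (r * t) * x.
Proof. by move=> h; rewrite /grow h leNgt (lt_le_trans x00). Qed.

Lemma grow_wait t x u : 0 < x < x0 -> u < surv t x -> grow t x u = x.
Proof. by move=> /andP[a b] h; rewrite /grow leNgt a/= leNgt b/= h. Qed.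

Lemma grow_jump t x u : 0 < x < x0 -> surv t x <= u ->
  grow t x u = (x + x0) * expR (r * t) * u `^ (x0 / x).
Proof.
by move=> /andP[a b] h; rewrite /grow leNgt a/= leNgt b/= ltNge h.
Qed.

Lemma grow_jump_ge t x u : 0 < x < x0 -> surv t x <= u -> x + x0 <= grow t x u.
Proof.
move=> h su; rewrite grow_jump//; have /andP[x_gt0 _] := h.
rewrite -[leLHS]mulr1 -mulrA ler_pM2l ?addr_gt0//.
have -> : 1 = expR (r * t) * surv t x `^ (x0 / x).
  by rewrite surv_powR// -expRD subrr expR0.
rewrite ler_pM2l ?expR_gt0//.
have u_gt0 : 0 < u := lt_le_trans (surv_gt0 _ _) su.
have s_gt0 := surv_gt0 t x.
by apply: ge0_ler_powR => //; rewrite ?nnegrE ?divr_ge0// ltW.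
Qed.

Lemma grow_ge t x u : 0 <= t -> Num.max x 0 <= grow t x u.
Proof.
move=> t0; have [xle|x_gt0] := leP x 0; first by rewrite grow_np.
have [xx0|xx0] := leP x0 x.
  by rewrite grow_above// ler_peMl ?(ltW x_gt0)// -expR0 ler_expR mulr_ge0// ltW.
have h : 0 < x < x0 by rewrite x_gt0.
have [su|us] := leP (surv t x) u; last by rewrite grow_wait.
by rewrite (le_trans _ (grow_jump_ge h su))// lerDl ltW.
Qed.

Lemma grow_ge0 t x u : 0 <= t -> 0 <= grow t x u.
Proof. by move=> t0; rewrite (le_trans _ (grow_ge x u t0))// le_max lexx orbT. Qed.

(** Waiting happens strictly below [x0], jumps land strictly above it, and [x0] itself is left at
    once. This keeps the kernel from [x0] out of the way at positive times. *)
Lemma grow_neq t x u : 0 <= t -> (0 < t) || (x != x0) -> grow t x u != x0.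
Proof.
move=> t0 tx; have [xle|x_gt0] := leP x 0; first by rewrite grow_np// lt_eqF.
have [xx0|xx0] := leP x0 x.
  rewrite grow_above// gt_eqF//; move: xx0; rewrite le_eqVlt => /predU1P[xx0|xx0].
    move: tx; rewrite -xx0 eqxx orbF => {}t0.
    by rewrite ltr_pMl// -expR0 ltr_expR mulr_gt0.
  by rewrite (lt_le_trans xx0)// ler_peMl ?(ltW x_gt0)// -expR0 ler_expR mulr_ge0// ltW.
have h : 0 < x < x0 by rewrite x_gt0.
have [su|us] := leP (surv t x) u; last by rewrite grow_wait// lt_eqF.
by rewrite gt_eqF// (lt_le_trans _ (grow_jump_ge h su))// ltrDr.
Qed.

(** The only situation in which the path after time [t] still depends on unrevealed information. *)
Definition waiting t x u := (0 < x < x0) && (u < surv t x).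

(** A path that is not waiting sits at 0 or at least at [x0], where the motion is deterministic;
    hence the fresh [v] does not matter. *)
Lemma growD s t x u v : 0 <= s -> 0 <= t -> ~~ waiting s x u ->
  grow t (grow s x u) v = grow (s + t) x u.
Proof.
move=> s0 t0; rewrite /waiting negb_and -!leNgt.
have [xle _|x_gt0] := leP x 0; first by rewrite !(grow_np _ _ xle) grow_np.
have [xx0 _|xx0] := leP x0 x.
  rewrite !(grow_above _ _ xx0) grow_above.
    by rewrite mulrA -expRD -mulrDr (addrC t).
  by rewrite (le_trans xx0)// ler_peMl ?(ltW x_gt0)// -expR0 ler_expR mulr_ge0// ltW.
have h : 0 < x < x0 by rewrite x_gt0.
rewrite /= => su.
rewrite [in LHS]grow_above; last first.
  by rewrite (le_trans _ (grow_jump_ge h su))// lerDr ltW.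
rewrite !grow_jump//; last by rewrite (le_trans _ su)// surv_nincr// lerDl.
rewrite mulrDr expRD.
by move: (expR (r * s)) (expR (r * t)) (u `^ _) => a b c; ring.
Qed.

(** Restarting at [s] amounts to rescaling [u], because [surv] is multiplicative in time; with
    [unif_dilation] this yields the Markov property while waiting. *)
Lemma grow_memoryless s t x u : 0 < x < x0 ->
  grow (s + t) x u = grow t x (u / surv s x).
Proof.
move=> h; have [us|su] := ltP u (surv (s + t) x).
  rewrite !grow_wait//.
  by rewrite ltr_pdivrMr ?surv_gt0// mulrC -survD.
have su' : surv t x <= u / surv s x.
  by rewrite ler_pdivlMr ?surv_gt0// mulrC -survD.
have u0 : 0 <= u by rewrite (le_trans _ su)// ltW// surv_gt0.
rewrite !grow_jump// powRM ?invr_ge0 ?(ltW (surv_gt0 _ _))//.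
have /andP[x_gt0 _] := h.
rewrite -powR_inv1 ?(ltW (surv_gt0 _ _))// powRAC surv_powR//.
rewrite powR_inv1 ?expR_ge0// -expRN opprK mulrDr expRD.
by move: (expR (r * s)) (expR (r * t)) (u `^ _) => a b c; ring.
Qed.

Lemma discounted_grow s t x u : 0 <= s -> s <= t -> ~~ waiting s x u ->
  expR (- (r * t)) * grow t x u = expR (- (r * s)) * grow s x u.
Proof.
move=> s0 st; rewrite /waiting negb_and -!leNgt.
have [xle _|x_gt0] := leP x 0; first by rewrite !grow_np// !mulr0.
have [xx0 _|xx0] := leP x0 x.
  by rewrite !grow_above// !mulrA -!expRD !addNr.
have h : 0 < x < x0 by rewrite x_gt0.
rewrite /= => su; rewrite !grow_jump//; last by rewrite (le_trans _ su)// surv_nincr.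
have K (y : R) : expR (- y) * expR y = 1 by rewrite -expRD addNr expR0.
move: (K (r * s)) (K (r * t)); move: (expR (- (r * s))) (expR (- (r * t))).
move: (expR (r * s)) (expR (r * t)) (u `^ _) => a b c a' b' aE bE.
transitivity ((b' * b) * ((x + x0) * c)); first by ring.
by rewrite bE -aE; ring.
Qed.

(* The quotient [x0 / x] is written with [expR] and [ln] because these are known
   to be measurable, unlike the inverse. *)
Lemma growE_ln t x u : grow t x u =
  if x <= 0 then 0 else if x0 <= x then expR (r * t) * x else
  if u < surv t x then x
  else (x + x0) * expR (r * t) * expR (x0 * expR (- ln x) * ln u).
Proof.
rewrite /grow; case: ifPn => //; rewrite -ltNge => x_gt0; case: ifPn => // _.
case: ifPn => //; rewrite -leNgt => su.
rewrite /powR gt_eqF ?(lt_le_trans (surv_gt0 _ _) su)//.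
by rewrite expRN lnK ?posrE.
Qed.

Lemma measurable_surv t : measurable_fun setT (surv t).
Proof.
apply: measurableT_comp => //; apply: measurableT_comp => //.
by apply: measurable_funM => //; exact: measurable_funM.
Qed.

Lemma measurable_grow t : measurable_fun setT (fun w : R * R => grow t w.1 w.2).
Proof.
under eq_fun do rewrite growE_ln.
have m1 : measurable_fun [set: R * R] fst by exact: measurable_fst.
have m2 : measurable_fun [set: R * R] snd by exact: measurable_snd.
apply: measurable_fun_ifT => //; first exact: measurable_fun_ler.
apply: measurable_fun_ifT; [exact: measurable_fun_ler|exact: measurable_funM|].
apply: measurable_fun_ifT => //.
  by apply: measurable_fun_ltr => //; exact: measurableT_comp (measurable_surv t) m1.
apply: measurable_funM.
  by apply: measurable_funM => //; exact: measurable_funD.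
apply: measurableT_comp => //; apply: measurable_funM.
  apply: measurable_funM => //; apply: measurableT_comp => //.
  by apply: measurableT_comp => //; exact: measurableT_comp.
exact: measurableT_comp.
Qed.

Lemma measurable_growx t x : measurable_fun setT (grow t x).
Proof.
exact: (measurableT_comp (measurable_grow t) (pair1_measurable x)).
Qed.

(** * The waiting event and integrals over it *)

Lemma set_waiting t x : 0 < x < x0 -> [set u | waiting t x u] = `]-oo, surv t x[%classic.
Proof.
by move=> h; apply/seteqP; split => u /=; rewrite /waiting h in_itv.
Qed.

Lemma set_waiting0 t x : ~~ (0 < x < x0) -> [set u | waiting t x u] = set0.
Proof.
by move=> h; apply/seteqP; split => u //=; rewrite /waiting (negbTE h).
Qed.

Lemma measurable_waiting t x : measurable [set u | waiting t x u].
Proof.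
by have [h|h] := boolP (0 < x < x0); [rewrite set_waiting|rewrite set_waiting0].
Qed.

Lemma unif_lt (p : R) : 0 < p <= 1 -> nu `]-oo, p[%classic = p%:E.
Proof.
move=> p01; have := unif_dilation p01 (@measurableT _ R).
rewrite probability_setT mule1 => <-; congr (nu _).
by apply/seteqP; split => u /=; rewrite in_itv/=; tauto.
Qed.

(** An event known at time [s] cannot separate two waiting values of [u], so it contains the waiting
    event or misses it. As the integrands agree elsewhere, a single comparison over the whole
    waiting event remains. *)
Lemma eq_integral_waiting s x (E : set R) (f g : R -> \bar R) :
  measurable E -> measurable_fun setT f -> measurable_fun setT g ->
  (forall u, 0 <= f u)%E -> (forall u, 0 <= g u)%E ->
  (forall u, ~~ waiting s x u -> f u = g u) ->
  (forall u v, waiting s x u -> waiting s x v -> E u -> E v) ->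
  (\int[nu]_(u in [set u | waiting s x u]) f u =
   \int[nu]_(u in [set u | waiting s x u]) g u)%E ->
  (\int[nu]_(u in E) f u = \int[nu]_(u in E) g u)%E.
Proof.
move=> mE mf mg f0 g0 fg cE fgW; set W := [set u | waiting s x u] in fgW.
have mW : measurable W by exact: measurable_waiting.
have key (h : R -> \bar R) : measurable_fun setT h -> (forall u, 0 <= h u)%E ->
    (\int[nu]_(u in E) h u =
     \int[nu]_(u in E `&` W) h u + \int[nu]_(u in E `\` W) h u)%E.
  move=> mh h0; rewrite -ge0_integral_setU//=.
  - by rewrite setDE -setIUr setUv setIT.
  - exact: measurableI.
  - exact: measurableD.
  - exact: measurable_funTS.
  - by apply/disj_setPS => u [[_ ?] [_]].
rewrite !key//; congr (_ + _)%E; last first.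
  by apply: eq_integral => u /set_mem[_] Wu; apply: fg; apply/negP.
have [[u [Eu Wu]]|no] := pselect (exists u, E u /\ W u).
  suff -> : E `&` W = W by [].
  by apply/seteqP; split => v; [case|move=> Wv; split=> //; exact: cE Eu].
suff -> : E `&` W = set0 by rewrite !integral_set0.
by apply/seteqP; split => v // [Ev Wv]; apply: no; exists v.
Qed.

Definition grow_law (t x : R) (A : set R) : \bar R := nu [set u | A (grow t x u)].

Lemma measurable_grow_preimage t x (A : set R) : measurable A ->
  measurable [set u | A (grow t x u)].
Proof.
by move=> mA; have := measurable_growx t x measurableT mA; rewrite setTI.
Qed.

Lemma surv01 s x : 0 <= s -> 0 < x < x0 -> 0 < surv s x <= 1.
Proof. by move=> s0 /andP[x_gt0 _]; rewrite surv_gt0 surv_le1. Qed.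

(** Both sides equal [surv s x * grow_law t x A]: the left one by dilation, the right one because
    the price has not moved. *)
Lemma integral_waiting_law s t x (A : set R) : 0 <= s -> measurable A ->
  (\int[nu]_(u in [set u | waiting s x u]) (\1_A (grow (s + t) x u))%:E =
   \int[nu]_(u in [set u | waiting s x u]) grow_law t (grow s x u) A)%E.
Proof.
move=> s0 mA; have [h|h] := boolP (0 < x < x0); last first.
  by rewrite (set_waiting0 _ h) !integral_set0.
have p01 := surv01 s0 h.
transitivity ((surv s x)%:E * grow_law t x A)%E.
  rewrite -unif_dilation//; last exact: measurable_grow_preimage.
  rewrite (_ : (fun u => _) = fun u => (\1_[set u | A (grow (s + t) x u)] u)%:E)//.
  rewrite integral_indic//; [|exact: measurable_waiting|exact: measurable_grow_preimage].
  congr (nu _); apply/seteqP; split => u /=; rewrite grow_memoryless// /waiting h/=.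
    by case.
  by case.
rewrite [RHS](_ : _ = \int[nu]_(u in [set u | waiting s x u]) cst (grow_law t x A) u)%E.
  rewrite integral_cst; last exact: measurable_waiting.
  by rewrite set_waiting//= unif_lt// muleC.
by apply: eq_integral => u /set_mem /= /andP[_ wu]; rewrite grow_wait.
Qed.

Lemma integral_powR (a p q : R) : 0 <= a -> 0 < p -> p <= q ->
  (\int[leb]_(u in `[p, q]) ((a + 1) * u `^ a)%:E = (q `^ (a + 1) - p `^ (a + 1))%:E)%E.
Proof.
move=> a0 p0; rewrite le_eqVlt => /predU1P[<-|pq].
  by rewrite set_itv1 integral_set1 subrr.
have cont b x : 0 < x -> {for x, continuous (fun u : R => u `^ b)}.
  move=> x0'; have /derivable1_diffP : derivable (fun u : R => u `^ b) x 1.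
    by have [] := is_derive1_powR b x0'.
  exact: differentiable_continuous.
rewrite EFinB; apply: (@continuous_FTC2 _ _ (fun u : R => u `^ (a + 1))) => //.
- apply: continuous_in_subspaceT => u /set_mem; rewrite /= in_itv/= => /andP[pu _].
  apply: cvgM; first exact: cvg_cst.
  by apply: cont; exact: lt_le_trans pu.
- split.
  + move=> u; rewrite in_itv/= => /andP[pu _].
    by have [] := is_derive1_powR (a + 1) (lt_trans p0 pu).
  + by apply/cvg_at_right_filter/cont.
  + by apply/cvg_at_left_filter/cont; exact: lt_trans pq.
- move=> u; rewrite in_itv/= => /andP[pu _].
  by rewrite powR_derive1 ?in_itv/= ?(lt_trans p0)// addrK.
Qed.

(** The last factor is written as the derivative of a power of [u], ready for [integral_powR]. *)
Lemma discounted_jump t x u : 0 < x < x0 -> surv t x <= u ->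
  expR (- (r * t)) * grow t x u = x * ((x0 / x + 1) * u `^ (x0 / x)).
Proof.
move=> h su; have /andP[x_gt0 _] := h.
rewrite grow_jump//.
have : expR (- (r * t)) * expR (r * t) = 1 by rewrite -expRD addNr expR0.
move: (expR _) (expR _) (u `^ _) => a b c ab.
transitivity ((b * a) * ((x + x0) * c)); first by ring.
by rewrite ab; field; rewrite gt_eqF.
Qed.

(** The balance of jump rate against jump size in integrated form: what discounting takes from the
    paths still waiting at [t] is returned by those that jump in between. *)
Lemma integral_waiting_discounted s t x : 0 <= s -> s <= t ->
  (\int[nu]_(u in [set u | waiting s x u]) (expR (- (r * t)) * grow t x u)%:E =
   \int[nu]_(u in [set u | waiting s x u]) (expR (- (r * s)) * grow s x u)%:E)%E.
Proof.
move=> s0 st; have t0 := le_trans s0 st.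
have [h|h] := boolP (0 < x < x0); last first.
  by rewrite (set_waiting0 _ h) !integral_set0.
have /andP[x_gt0 _] := h.
have p01 := surv01 s0 h; have /andP[p0 p1] := p01.
have /andP[q0 q1] := surv01 t0 h.
have qp : surv t x <= surv s x by exact: surv_nincr.
set f := fun u => (expR (- (r * t)) * grow t x u)%:E.
have f0 u : (0 <= f u)%E by rewrite lee_fin mulr_ge0 ?expR_ge0// grow_ge0.
have mf : measurable_fun setT f.
  by apply/measurable_EFinP; apply: measurable_funM => //; exact: measurable_growx.
rewrite [RHS](_ : _ = \int[nu]_(u in [set u | waiting s x u]) cst (expR (- (r * s)) * x)%:E u)%E; last first.
  by apply: eq_integral => u /set_mem /= /andP[_ wu]; rewrite grow_wait.
rewrite integral_cst; last exact: measurable_waiting.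
rewrite set_waiting//= unif_lt//.
rewrite integral_mkcond ge0_integral_unif; last 2 first.
- apply/(measurable_restrictT _ _).1 => //; exact: measurable_funTS.
- by move=> u; apply: erestrict_ge0 => v _; exact: f0.
rewrite -integral_mkcondr.
(* The waiting event at [s] is cut at [surv t x]: below the cut the path still waits at [t], above
   it the jump has occurred. *)
have -> : `[0, 1]%classic `&` `]-oo, surv s x[%classic =
    `[0, surv t x[%classic `|` `[surv t x, surv s x[%classic.
  apply/seteqP; split => u /=; rewrite !in_itv/=.
    by move=> [/andP[-> _] ->]; rewrite andbT; case: ltP; [left|right].
  case=> /andP[ul uu]; split => //.
  - by rewrite ul/= (le_trans (ltW uu)).
  - exact: lt_le_trans uu _.
  - by rewrite (le_trans (ltW q0))//= (le_trans (ltW uu)).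
rewrite ge0_integral_setU//=; last 3 first.
- exact: measurable_funTS.
- by move=> u _; exact: f0.
- by apply/disj_setPS => u /=; rewrite !in_itv/= => -[/andP[_ +] /andP[+ _]]; case: ltP.
rewrite (@eq_integral _ _ _ _ _ (cst (expR (- (r * t)) * x)%:E)); last first.
  move=> u /set_mem /=; rewrite in_itv/= => /andP[_ uq].
  by rewrite /f grow_wait.
rewrite integral_cst//= lebesgue_measure_itv/= lte_fin q0.
rewrite (@integral_itv_bndo_bndc _ (BLeft _)); last exact: measurable_funTS.
under eq_integral.
  move=> u /set_mem /=; rewrite in_itv/= => /andP[qu _].
  rewrite /f discounted_jump// EFinM; over.
rewrite /= ge0_integralZl//=; last 3 first.
- by apply/measurable_EFinP; apply: measurable_funM => //; exact: measurable_funTS.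
- by move=> u _; rewrite lee_fin mulr_ge0 ?powR_ge0// addr_ge0// divr_ge0// ltW.
- by rewrite lee_fin ltW.
rewrite integral_powR// ?divr_ge0 ?(ltW x00) ?(ltW x_gt0)//.
rewrite oppr0 adde0 -!EFinM -EFinD; congr EFin.
(* This power of a survival probability is that probability times the discount factor, so the
   contributions at [t] of the two pieces cancel. *)
have K z : surv z x `^ (x0 / x + 1) = surv z x * expR (- (r * z)).
  rewrite powRD; last by rewrite (gt_eqF (surv_gt0 _ _)) implybT.
  by rewrite surv_powR// powRr1 ?(ltW (surv_gt0 _ _))// mulrC.
rewrite !K; ring.
Qed.

Lemma measurable_grow_law t (A : set R) : measurable A ->
  measurable_fun setT (grow_law t ^~ A).
Proof.
move=> mA; pose G := (fun w : R * R => grow t w.1 w.2) @^-1` A.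
have mG : measurable G.
  by rewrite -[G]setTI; exact: measurable_grow.
have := measurable_fun_xsection nu mG; apply: eq_measurable_fun => x _ /=.
by congr (nu _); apply/seteqP; split => u /=; rewrite /xsection/= in_setE.
Qed.

Lemma grow_law_waitingN s t x u A : 0 <= s -> 0 <= t -> ~~ waiting s x u ->
  grow_law t (grow s x u) A = (\1_A (grow (s + t) x u) : R)%:E.
Proof.
move=> s0 t0 wu; rewrite /grow_law.
under eq_set do rewrite growD//.
rewrite indicE; have [Ay|Ay] := boolP (_ \in A).
  rewrite (_ : mkset _ = setT) ?probability_setT//.
  by apply/seteqP; split => // v _; exact: set_mem.
rewrite (_ : mkset _ = set0) ?measure0//.
by apply/seteqP; split => // v /= /mem_set; rewrite (negbTE Ay).
Qed.

Lemma measurable_indic_grow t x (A : set R) : measurable A ->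
  measurable_fun setT (fun u => (\1_A (grow t x u) : R)%:E).
Proof.
move=> mA; apply/measurable_EFinP.
by apply: (measurableT_comp (measurable_indic mA)); exact: measurable_growx.
Qed.

Lemma chapman_grow_law s t x (A : set R) : 0 <= s -> 0 <= t -> measurable A ->
  grow_law (s + t) x A = (\int[nu]_u grow_law t (grow s x u) A)%E.
Proof.
move=> s0 t0 mA; transitivity (\int[nu]_u (\1_A (grow (s + t) x u) : R)%:E)%E.
  rewrite (_ : (fun u => _) = fun u => (\1_[set u | A (grow (s + t) x u)] u : R)%:E)//.
  by rewrite integral_indic ?setIT//; exact: measurable_grow_preimage.
apply: (@eq_integral_waiting s x) => //.
- exact: measurable_indic_grow.
- exact: (measurableT_comp (measurable_grow_law t mA) (measurable_growx _ _)).
- by move=> u wu; rewrite grow_law_waitingN.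
- exact: integral_waiting_law.
Qed.

(** * The process on the product space and its filtration *)

Variable mu : probability R R.
Local Notation Pr := (mu \x nu)%E.

(** By Tonelli, [eq_integral_waiting] is applied on each fibre over a fixed level [x]. *)
Lemma integral_prod_waiting s (E : set (R * R)) (f g : R * R -> \bar R) :
  measurable E -> measurable_fun setT f -> measurable_fun setT g ->
  (forall w, 0 <= f w)%E -> (forall w, 0 <= g w)%E ->
  (forall x u, ~~ waiting s x u -> f (x, u) = g (x, u)) ->
  (forall x u v, waiting s x u -> waiting s x v -> E (x, u) -> E (x, v)) ->
  (forall x, \int[nu]_(u in [set u | waiting s x u]) f (x, u) =
   \int[nu]_(u in [set u | waiting s x u]) g (x, u))%E ->
  (\int[Pr]_(w in E) f w = \int[Pr]_(w in E) g w)%E.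
Proof.
move=> mE mf mg f0 g0 fg cE fgW.
have key (h : R * R -> \bar R) : measurable_fun setT h -> (forall w, 0 <= h w)%E ->
    (\int[Pr]_(w in E) h w =
     \int[mu]_x \int[nu]_(u in [set u | E (x, u)]) h (x, u))%E.
  move=> mh h0; rewrite integral_mkcond fubini_tonelli1; last 2 first.
  - by apply/(measurable_restrictT _ _).1 => //; exact: measurable_funTS.
  - by move=> w; apply: erestrict_ge0.
  apply: eq_integral => x _; rewrite /fubini_F [RHS]integral_mkcond.
  apply: eq_integral => u _; rewrite !patchE.
  by congr (if _ then _ else _); apply/idP/idP => /set_mem ?; exact/mem_set.
rewrite (key _ mf f0) (key _ mg g0); apply: eq_integral => x _.
have p1 := pair1_measurable (T2 := R) x.
apply: (@eq_integral_waiting s x) => //.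
- by rewrite -[mkset _]setTI; exact: (p1 measurableT).
- exact: measurableT_comp.
- exact: measurableT_comp.
- by move=> u; exact: fg.
- by move=> u v; exact: cE.
Qed.

Definition price (t : R) (w : R * R) : R :=
  if t <= 0 then x0 else grow t w.1 w.2.

(* The information at time [s]: the level [x], and also [u] unless the process is
   still waiting. *)
Definition jump_history (s : R) : set (set (R * R)) :=
  [set A | measurable A /\ exists2 B : set R, measurable B &
     forall x u, waiting s x u -> (A (x, u) <-> B x)].

(** The level is hidden at time 0, although the price reveals it immediately afterwards. *)
Definition price_filtration (t : R) : set (set (R * R)) :=
  if t <= 0 then [set set0; setT] else jump_history t.

Lemma waiting_le s t x u : s <= t -> waiting t x u -> waiting s x u.
Proof.
move=> st /andP[h ut]; have /andP[x_gt0 _] := h.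
by rewrite /waiting h/= (lt_le_trans ut)// surv_nincr.
Qed.

Lemma price_filtration_trivial t A : set0 = A \/ setT = A -> price_filtration t A.
Proof.
rewrite /price_filtration; case: ifPn => _ h; first by case: h => <-; [left|right].
by case: h => <-; split => //; [exists set0|exists setT].
Qed.

Lemma sigma_algebra_price_filtration t : sigma_algebra setT (price_filtration t).
Proof.
split; first by apply: price_filtration_trivial; left.
- move=> A; rewrite setTD /price_filtration; case: ifPn => _.
    by case=> ->; [right; rewrite setC0|left; rewrite setCT].
  move=> [mA [B mB AB]]; split; first exact: measurableC.
  by exists (~` B); [exact: measurableC|move=> x u /AB; rewrite /setC/=; tauto].
move=> A; rewrite /price_filtration; case: ifPn => _ hA.
  have [[k Ak]|no] := pselect (exists k, A k = setT); [right|left].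
    by apply/seteqP; split => // w _; exists k => //; rewrite Ak.
  apply/seteqP; split => // w [k _].
  by case: (hA k) => [->//|Ak]; exfalso; apply: no; exists k.
have /choice[B hB] : forall k, exists B : set R, measurable B /\
    forall x u, waiting t x u -> (A k (x, u) <-> B x).
  by move=> k; have [_ [B mB h]] := hA k; exists B.
split; first by apply: bigcup_measurable => k _; have [] := hA k.
exists (\bigcup_k B k).
  by apply: bigcup_measurable => k _; have [] := hB k.
move=> x u wu; split => -[k _ h]; exists k => //.
  by have [_ /(_ _ _ wu)[]] := hB k; auto.
by have [_ /(_ _ _ wu)[]] := hB k; auto.
Qed.

Lemma price_filtration_measurable t : price_filtration t `<=` measurable.
Proof. by rewrite /price_filtration; case: ifPn => _ A; [case=> ->|case]. Qed.

Lemma is_filtration_price : is_filtration price_filtration.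
Proof.
split=> [t _|s t s0 st A].
  by split; [exact: sigma_algebra_price_filtration|exact: price_filtration_measurable].
rewrite {1}/price_filtration; case: ifPn => sle.
  by case=> ->; apply: price_filtration_trivial; [left|right].
rewrite /price_filtration leNgt (lt_le_trans _ st) ?ltNge//.
move=> [mA [B mB AB]]; split=> //; exists B => // x u /(waiting_le st).
exact: AB.
Qed.

Lemma price_le0 t : t <= 0 -> price t = cst x0.
Proof. by move=> t0; apply/funext => w; rewrite /price t0. Qed.

Lemma price_gt0 t : 0 < t -> price t = fun w => grow t w.1 w.2.
Proof. by move=> t0; apply/funext => w; rewrite /price leNgt t0. Qed.

Lemma measurable_price t : measurable_fun setT (price t).
Proof.
have [t0|t0] := leP t 0; first by rewrite price_le0.
by rewrite price_gt0//; exact: measurable_grow.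
Qed.

Lemma adapted_price : adapted price_filtration price.
Proof.
move=> t _ B mB; have [t0|t0] := leP t 0.
  rewrite price_le0//; apply: price_filtration_trivial.
  by rewrite preimage_cst; case: ifPn => _; [right|left].
rewrite price_gt0// /price_filtration leNgt t0/=.
split; first by rewrite -[_ @^-1` _]setTI; exact: measurable_grow.
exists B => // x u /andP[h us]; rewrite /preimage/= grow_wait//.
Qed.

Lemma measurable_wrt_price t (h : R -> R) : 0 <= t -> measurable_fun setT h ->
  measurable_wrt (price_filtration t) (h \o price t).
Proof.
move=> t0 mh B mB; rewrite comp_preimage; apply: adapted_price => //.
by rewrite -[_ @^-1` _]setTI; exact: mh.
Qed.

(** * Transition kernels and the Markov property *)

Section transition.
Variable t : R.

HB.instance Definition _ := @isMeasurableFun.Build _ _ _ _ (price t) (measurable_price t).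
HB.instance Definition _ x := @isMeasurableFun.Build _ _ _ _ (grow t x) (measurable_growx t x).

(** From [x0] the kernel performs the jump to [mu] and then the growth; from every other level there
    is growth only. *)
Definition transition (x : R) : {measure set R -> \bar R} :=
  if t <= 0 then (dirac x : {measure set R -> \bar R}) else
  if x == x0 then (distribution Pr (price t) : {measure set R -> \bar R})
  else (distribution nu (grow t x) : {measure set R -> \bar R}).

Lemma transitionE x A : transition x A =
  if t <= 0 then \d_x A else
  if x == x0 then Pr (price t @^-1` A) else grow_law t x A.
Proof. by rewrite /transition; case: ifPn => // _; case: ifPn. Qed.

Lemma measurable_transition (A : set R) : measurable A ->
  measurable_fun setT (transition ^~ A).
Proof.
move=> mA; under eq_fun do rewrite transitionE.
apply: measurable_fun_ifT => //.
  by apply/measurable_EFinP; exact: measurable_indic.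
apply: measurable_fun_ifT => //; last exact: measurable_grow_law.
exact: measurable_fun_eqr.
Qed.

HB.instance Definition _ := isKernel.Build _ _ _ _ _ transition measurable_transition.

Lemma transition_setT x : transition x setT = 1%E.
Proof.
rewrite transitionE; case: ifPn => _; first by rewrite diracT.
by case: ifPn => _; rewrite ?preimage_setT; apply: probability_setT.
Qed.

HB.instance Definition _ := Kernel_isProbability.Build _ _ _ _ _ transition transition_setT.
End transition.

Lemma transition_grow t y A : 0 < t -> y != x0 -> transition t y A = grow_law t y A.
Proof. by move=> t0 /negbTE yx0; rewrite transitionE leNgt t0 yx0. Qed.

Lemma price_law t (A : set R) : measurable A -> Pr (price t @^-1` A) = transition t x0 A.
Proof.
move=> mA; rewrite transitionE eqxx; case: ifPn => // t0.
rewrite price_le0// preimage_cst diracE.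
by case: ifPn => _; [rewrite probability_setT|rewrite measure0].
Qed.

Lemma integral_indic_price t (A : set R) : measurable A ->
  (\int[Pr]_w (\1_A (price t w) : R)%:E = transition t x0 A)%E.
Proof.
move=> mA; rewrite (_ : (fun w => _) = fun w => (\1_(price t @^-1` A) w : R)%:E)//.
have mpA : measurable (price t @^-1` A).
  by rewrite -[_ @^-1` _]setTI; exact: measurable_price.
by rewrite integral_indic// setIT; exact: price_law.
Qed.

Lemma measurable_indic_price t (A : set R) : measurable A ->
  measurable_fun setT (fun w => (\1_A (price t w) : R)%:E).
Proof.
move=> mA; apply/measurable_EFinP.
by apply: (measurableT_comp (measurable_indic mA)); exact: measurable_price.
Qed.

(** At [s = 0] this is the definition of the kernel from [x0]. For [s > 0] the price differs from
    [x0], so the kernel is [grow_law]: a Dirac mass off the waiting event, handled by lack of memory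
    on it. *)
Lemma markov_price s t (A : set R) E : 0 <= s -> 0 <= t -> measurable A -> price_filtration s E ->
  (\int[Pr]_(w in E) transition t (price s w) A =
   \int[Pr]_(w in E) (\1_A (price (s + t) w) : R)%:E)%E.
Proof.
rewrite le_eqVlt => /predU1P[<-|s0] t0 mA.
  rewrite /price_filtration lexx => -[->|->]; first by rewrite !integral_set0.
  rewrite add0r integral_indic_price// price_le0//= integral_cst// -[RHS]mule1.
  by congr (_ * _)%E; exact: probability_setT.
move: t0; rewrite le_eqVlt => /predU1P[<- _|t0].
  by apply: eq_integral => w _; rewrite transitionE lexx diracE addr0 indicE.
rewrite /price_filtration leNgt s0/= => -[mE [B mB EB]].
apply: (@integral_prod_waiting s) => //.
- apply: (measurableT_comp (measurable_transition t mA)).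
  exact: measurable_price.
- exact: measurable_indic_price.
- move=> x u wu; rewrite !price_gt0 ?addr_gt0//=.
  rewrite transition_grow ?grow_neq ?(ltW s0) ?s0//.
  by rewrite grow_law_waitingN// ltW.
- by move=> x u v xu xv /(EB _ _ xu) /(EB _ _ xv).
- move=> x; rewrite !price_gt0 ?addr_gt0//=.
  rewrite (integral_waiting_law _ _ (ltW s0))//; apply: eq_integral => u _.
  by rewrite transition_grow ?grow_neq ?(ltW s0) ?s0.
Qed.

Lemma transition_le1 t x (A : set R) : measurable A -> (transition t x A <= 1)%E.
Proof.
move=> mA; rewrite -(transition_setT t x).
by apply: le_measure; rewrite ?inE.
Qed.

Lemma transition_fin_num t x (A : set R) : measurable A -> transition t x A \is a fin_num.
Proof.
move=> mA; rewrite ge0_fin_numE ?measure_ge0//.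
by rewrite (le_lt_trans (transition_le1 _ _ mA))// ltry.
Qed.

Lemma transition0 x : transition 0 x = (dirac x : {measure set R -> \bar R}).
Proof. by rewrite /transition lexx. Qed.

Lemma transition_start t : 0 < t ->
  transition t x0 = (distribution Pr (price t) : {measure set R -> \bar R}).
Proof. by move=> t0; rewrite /transition leNgt t0 eqxx. Qed.

Lemma transition_neq t x : 0 < t -> x != x0 ->
  transition t x = (distribution nu (grow t x) : {measure set R -> \bar R}).
Proof. by move=> t0 /negbTE xx0; rewrite /transition leNgt t0 xx0. Qed.

Lemma chapman_transition_l0 t x (A : set R) : measurable A ->
  transition t x A = (\int[transition 0 x]_y transition t y A)%E.
Proof.
move=> mA.
have E := transition0 x.
pose f y := transition t y A.
have mf : measurable_fun setT f by exact: measurable_transition.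
change (f x = (\int[transition 0 x]_y f y)%E).
by rewrite E (integral_dirac x measurableT mf) diracT mul1e.
Qed.

Lemma chapman_transition_r0 s x (A : set R) : measurable A ->
  transition s x A = (\int[transition s x]_y transition 0 y A)%E.
Proof.
move=> mA; transitivity (\int[transition s x]_y (\1_A y : R)%:E)%E.
  by rewrite integral_indic// setIT.
by apply: eq_integral => y _; rewrite transitionE lexx diracE indicE.
Qed.

(** From [x0] the identity is the Markov property of the price itself on the sure event; from other
    levels it is [chapman_grow_law], since the path avoids [x0]. *)
Lemma chapman_transition_gt0 s t x (A : set R) : 0 < s -> 0 < t -> measurable A ->
  transition (s + t) x A = (\int[transition s x]_y transition t y A)%E.
Proof.
move=> s0 t0 mA; pose f y := transition t y A.
have mf : measurable_fun setT f by exact: measurable_transition.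
have f0 y : (0 <= f y)%E by exact: measure_ge0.
change (transition (s + t) x A = (\int[transition s x]_y f y)%E).
have [->|xx0] := eqVneq x x0.
  rewrite (transition_start s0) ge0_integral_distribution//.
  rewrite -integral_indic_price// -markov_price ?ltW//.
  by apply: price_filtration_trivial; right.
rewrite (transition_neq s0 xx0) ge0_integral_distribution//.
rewrite transition_grow ?addr_gt0// chapman_grow_law ?ltW//.
apply: eq_integral => u _ /=; rewrite /f.
by rewrite transition_grow ?grow_neq ?(ltW s0) ?s0.
Qed.

Lemma chapman_transition s t x (A : set R) : 0 <= s -> 0 <= t -> measurable A ->
  transition (s + t) x A = (\int[transition s x]_y transition t y A)%E.
Proof.
move=> s0 t0 mA; have [s0'|s0'] := eqVneq s 0.
  subst s; apply: etrans (chapman_transition_l0 t x mA).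
  by congr (transition _ x A); rewrite add0r.
have [t0'|t0'] := eqVneq t 0.
  subst t; apply: etrans (chapman_transition_r0 s x mA).
  by congr (transition _ x A); rewrite addr0.
by apply: chapman_transition_gt0; rewrite // lt0r ?s0' ?t0'.
Qed.

Lemma transition_function_transition : transition_function (fun t => transition t).
Proof.
split=> [x A mA|s t x A]; first by rewrite transitionE lexx.
exact: chapman_transition.
Qed.

Lemma time_homogeneous_markov_price : time_homogeneous_markov Pr price_filtration price.
Proof.
split; first exact: adapted_price.
exists (fun t => transition t); split; first exact: transition_function_transition.
move=> s t A s0 t0 mA.
have mQ : measurable_fun setT (fun y => fine (transition t y A)).
  by apply: measurableT_comp => //; exact: measurable_transition.
split.
- exact: (measurable_wrt_price s0 mQ).
- apply: (@le_integrable _ _ _ _ _ measurableT _ (cst 1%E)) => //.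
  + by apply/measurable_EFinP; apply: (measurableT_comp mQ); exact: measurable_price.
  + move=> w _ /=; rewrite normr1 ger0_norm ?fine_ge0// -[leRHS]/(1%:E)%E fineK ?transition_fin_num//.
    exact: transition_le1.
  + exact: finite_measure_integrable_cst.
- move=> E EF; rewrite -markov_price//; apply: eq_integral => w _.
  by rewrite fineK// transition_fin_num.
Qed.

(** * The discounted price as a martingale *)

Definition dgrow (t x u : R) : R := expR (- (r * t)) * grow t x u.

Lemma dgrow_ge0 t x u : 0 <= t -> 0 <= dgrow t x u.
Proof. by move=> t0; rewrite mulr_ge0 ?expR_ge0// grow_ge0. Qed.

Lemma measurable_dgrow t : measurable_fun setT (fun w : R * R => dgrow t w.1 w.2).
Proof. by apply: measurable_funM => //; exact: measurable_grow. Qed.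

Lemma measurable_dgrowx t x : measurable_fun setT (dgrow t x).
Proof. by apply: measurable_funM => //; exact: measurable_growx. Qed.

(** At time 0 every [u < 1] is waiting, and [u >= 1] is negligible, so the waiting identity with
    [s = 0] gives the full expectation; outside []0, x0[] the discounted value is constant. *)
Lemma integral_dgrow t x : 0 <= t ->
  (\int[nu]_u (dgrow t x u)%:E = (Num.max x 0)%:E)%E.
Proof.
move=> t0; have [h|h] := boolP (0 < x < x0); last first.
  have E u : dgrow t x u = Num.max x 0.
    rewrite /dgrow; have [xle|x_gt0] := leP x 0; first by rewrite grow_np// mulr0.
    have xx0 : x0 <= x by move: h; rewrite x_gt0 -leNgt.
    rewrite grow_above//.
    by rewrite mulrA -expRD addNr expR0 mul1r.
  transitivity (\int[nu]_u cst (Num.max x 0)%:E u)%E.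
    by apply: eq_integral => u _; rewrite E.
  by rewrite integral_cst//= probability_setT mule1.
have /andP[x_gt0 _] := h.
have s1 : surv 0 x = 1 by rewrite /surv mulr0 mul0r oppr0 expR0.
have nu0 : nu `[1, +oo[%classic = 0%E.
  rewrite unifE// (_ : _ `&` _ = set0) ?measure0//.
  by apply/seteqP; split => u //=; rewrite !in_itv/= => -[+ /andP[_ +]]; case: ltP.
have mM : measurable_fun setT (EFin \o dgrow t x).
  by apply/measurable_EFinP; exact: measurable_dgrowx.
rewrite (@ge0_negligible_integral _ _ _ nu setT (`[1, +oo[%classic : set R))//; last first.
  by move=> u _; rewrite lee_fin dgrow_ge0.
rewrite setTD setCitvr -s1 -set_waiting// integral_waiting_discounted//.
transitivity (\int[nu]_(u in [set u | waiting 0 x u]) cst x%:E u)%E.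
  apply: eq_integral => u /set_mem/= /andP[_ us].
  by rewrite grow_wait// mulr0 oppr0 expR0 mul1r.
rewrite integral_cst; last exact: measurable_waiting.
rewrite set_waiting// s1/= unif_lt ?lexx ?ltr01// mule1.
by rewrite max_l// ltW.
Qed.

Hypothesis mean_mu : (\int[mu]_x (Num.max x 0)%:E = x0%:E)%E.

Definition dprice (t : R) (w : R * R) : R := expR (- (r * t)) * price t w.

Lemma dprice_gt0 t : 0 < t -> dprice t = fun w => dgrow t w.1 w.2.
Proof. by move=> t0; rewrite /dprice price_gt0. Qed.

Lemma dprice0 : dprice 0 = cst x0.
Proof. by rewrite /dprice price_le0//; apply/funext => w; rewrite mulr0 oppr0 expR0 mul1r. Qed.

Lemma dprice_ge0 t w : 0 <= t -> 0 <= dprice t w.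
Proof.
rewrite le_eqVlt => /predU1P[<-|t0]; first by rewrite dprice0 ltW.
by rewrite dprice_gt0// dgrow_ge0// ltW.
Qed.

Lemma measurable_dprice t : measurable_fun setT (dprice t).
Proof. by apply: measurable_funM => //; exact: measurable_price. Qed.

Lemma integral_dprice t : 0 <= t -> (\int[Pr]_w (dprice t w)%:E = x0%:E)%E.
Proof.
rewrite le_eqVlt => /predU1P[<-|t0].
  transitivity (\int[Pr]_w cst x0%:E w)%E; first by rewrite dprice0.
  rewrite integral_cst// -[RHS]mule1.
  by congr (_ * _)%E; exact: probability_setT.
rewrite dprice_gt0// fubini_tonelli1; last 2 first.
- by apply/measurable_EFinP; exact: measurable_dgrow.
- by move=> w; rewrite lee_fin dgrow_ge0 ?ltW.
rewrite -mean_mu; apply: eq_integral => x _.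
exact: integral_dgrow (ltW t0).
Qed.

Lemma integrable_dprice t : 0 <= t -> Pr.-integrable setT (EFin \o dprice t).
Proof.
move=> t0; apply/integrableP; split.
  by apply/measurable_EFinP; exact: measurable_dprice.
rewrite (_ : integral _ _ _ = x0%:E) ?ltry// -(integral_dprice t0).
by apply: eq_integral => w _ /=; rewrite ger0_norm// dprice_ge0.
Qed.

Lemma dprice_cond s t E : 0 <= s -> s <= t -> price_filtration s E ->
  (\int[Pr]_(w in E) (dprice s w)%:E = \int[Pr]_(w in E) (dprice t w)%:E)%E.
Proof.
move=> + st; rewrite le_eqVlt => /predU1P[s0|s0].
  rewrite -s0 in st *; rewrite /price_filtration lexx => -[->|->].
    by rewrite !integral_set0.
  by rewrite !integral_dprice.
have t0 := lt_le_trans s0 st.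
rewrite /price_filtration leNgt s0/= => -[mE [B mB EB]].
rewrite (dprice_gt0 s0) (dprice_gt0 t0).
apply: (@integral_prod_waiting s).
- exact: mE.
- by apply/measurable_EFinP; exact: measurable_dgrow.
- by apply/measurable_EFinP; exact: measurable_dgrow.
- by move=> w; rewrite lee_fin dgrow_ge0 ?ltW.
- by move=> w; rewrite lee_fin dgrow_ge0 ?ltW.
- move=> x u wu; congr EFin; apply/esym.
  exact: discounted_grow (ltW s0) st wu.
- by move=> x u v xu xv /(EB _ _ xu) /(EB _ _ xv).
- move=> x; apply/esym.
  exact: integral_waiting_discounted (ltW s0) st.
Qed.

Lemma adapted_dprice : adapted price_filtration dprice.
Proof.
move=> t t0; have mh : measurable_fun setT (fun y : R => expR (- (r * t)) * y).
  exact: measurable_funM.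
exact: (measurable_wrt_price t0 mh).
Qed.

Lemma martingale_dprice : martingale Pr price_filtration dprice.
Proof.
split; [exact: adapted_dprice|exact: integrable_dprice|].
move=> s t s0 st; split.
- exact: adapted_dprice.
- exact: integrable_dprice.
- by move=> A FA; exact: dprice_cond.
Qed.

Lemma local_martingale_dprice : local_martingale Pr price_filtration dprice.
Proof.
split; first exact: adapted_dprice.
(* The discounted price is a true martingale, so no localization takes place. *)
exists (fun _ _ => +oo%E); split.
- move=> _; split => [w|t t0]; first by rewrite leey.
  rewrite (_ : mkset _ = set0); last by apply/seteqP; split.
  by apply: price_filtration_trivial; left.
- by apply: aeW => w m n _.
- by apply: aeW => w; exact: cvg_cst.
- move=> _; rewrite (_ : stopped _ _ = dprice); first exact: martingale_dprice.
  by apply/funext => t; apply/funext => w; rewrite /stopped minEle leye_eq.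
Qed.

(** Waiting is the strict condition [u < surv t x], hence open in [t] and kept slightly to the
    right; a path that has jumped stays on the same exponential branch. *)
Lemma right_continuous_price w t : 0 < t -> price ^~ w @ at_right t --> price t w.
Proof.
case: w => x u t0; rewrite price_gt0//=.
have cE (c : R) : (fun s => expR (r * s) * c) @ at_right t --> expR (r * t) * c.
  apply: cvg_at_right_filter; apply: cvgMl; apply: continuous_comp; last exact: continuous_expR.
  exact: mulrl_continuous.
have [xle|x_gt0] := leP x 0.
  apply: (@cvg_trans _ (cst 0 @ at_right t)); last by rewrite grow_np//; exact: cvg_cst.
  apply: near_eq_cvg; near=> s.
  have ts : t < s by near: s; exact: nbhs_right_gt.
  have s0 := lt_trans t0 ts.
  by rewrite price_gt0//= grow_np.
have [xx0|xx0] := leP x0 x.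
  rewrite grow_above//; apply: cvg_trans (cE x).
  apply: near_eq_cvg; near=> s.
  have ts : t < s by near: s; exact: nbhs_right_gt.
  have s0 := lt_trans t0 ts.
  by rewrite price_gt0//= grow_above.
have h : 0 < x < x0 by rewrite x_gt0.
have [su|us] := leP (surv t x) u.
  rewrite grow_jump// mulrAC mulrC; apply: cvg_trans (cE _).
  apply: near_eq_cvg; near=> s.
  have ts : t < s by near: s; exact: nbhs_right_gt.
  have s0 := lt_trans t0 ts.
  rewrite price_gt0//= grow_jump//; last first.
    by apply: le_trans su; apply: surv_nincr => //; exact: ltW.
  by rewrite mulrAC [RHS]mulrC.
rewrite grow_wait//; apply: (@cvg_trans _ (cst x @ at_right t)); last exact: cvg_cst.
apply: near_eq_cvg; near=> s.
  have ts : t < s by near: s; exact: nbhs_right_gt.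
  have s0 := lt_trans t0 ts.
rewrite price_gt0//= grow_wait//; near: s.
have cs : surv ^~ x s @[s --> at_right t] --> surv t x.
  apply: cvg_at_right_filter; apply: continuous_comp; last exact: continuous_expR.
  apply: cvgN; apply: cvgM; [exact: mulrl_continuous|exact: cvg_cst].
exact: (cvgr_gt _ cs).
Unshelve. all: by end_near. Qed.

(** * The value of the put *)

Section put.
Variables (K p : R).
Hypothesis K0 : 0 < K.
Hypothesis put_mu : (\int[mu]_x (Num.max (K - Num.max x 0) 0)%:E = p%:E)%E.

Let measurable_maxr0 : measurable_fun setT (fun x : R => Num.max x 0).
Proof. exact: measurable_maxr. Qed.

Let measurable_put (c : R) : measurable_fun setT (fun x : R => Num.max (c - x) 0).
Proof. by apply: measurable_maxr => //; exact: measurable_funB. Qed.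

Let measurable_put0 (c : R) : measurable_fun setT (fun x : R => Num.max (c - Num.max x 0) 0).
Proof. exact: (measurableT_comp (measurable_put c) measurable_maxr0). Qed.

(** Integrate [K <= (K - y)^+ + y] against the law of the level, whose mean is [x0]. This bounds
    exercise at time 0. *)
Lemma intrinsic_le_put : Num.max (K - x0) 0 <= p.
Proof.
rewrite ge_max -!lee_fin -put_mu; apply/andP; split; last first.
  by apply: integral_ge0 => x _; rewrite lee_fin le_max lexx orbT.
rewrite EFinB leeBlDr// put_mu -mean_mu -put_mu.
rewrite -ge0_integralD//; last 4 first.
- by move=> x _; rewrite lee_fin le_max lexx orbT.
- by apply/measurable_EFinP.
- by move=> x _; rewrite lee_fin le_max lexx orbT.
- by apply/measurable_EFinP.
apply: (@le_trans _ _ (\int[mu]_x cst K%:E x)%E).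
  by rewrite integral_cst//= probability_setT mule1.
apply: ge0_le_integral_nonmeasurable => x; first by rewrite lee_fin ltW.
by rewrite -EFinD lee_fin -lerBlDr le_max lexx.
Qed.

(** If [tau] is 0 everywhere, the payoff is [(K - x0)^+]. If it is positive everywhere, the price at
    [tau] is at least the initial level and the discount at most 1, so the bound holds path by
    path. *)
Lemma expectation_put_le tau : stopping_time price_filtration tau ->
  ('E_Pr[put_payoff r K price tau] <= p%:E)%E.
Proof.
move=> [tau0 Ftau]; rewrite unlock.
have payoff_ge0 w : 0 <= put_payoff r K price tau w.
  rewrite /put_payoff; case: (tau w) => [t| |]//.
  by rewrite mulr_ge0 ?expR_ge0// le_max lexx orbT.
have PT : Pr setT = 1%E by exact: probability_setT.
have := Ftau 0 (lexx _); rewrite /price_filtration lexx => -[tau_gt0|tau_le0]; last first.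
  apply: (@le_trans _ _ (\int[Pr]_w cst p%:E w)%E); last first.
    rewrite integral_cst// -[leRHS]mule1; apply: lee_pmul => //.
      by rewrite lee_fin (le_trans _ intrinsic_le_put)// le_max lexx orbT.
    by rewrite -PT.
  apply: ge0_le_integral_nonmeasurable => w; rewrite lee_fin//.
  have := tau0 w; have : setT w by []; rewrite -tau_le0 /= /put_payoff.
  case: (tau w) => [t| |]//; rewrite !lee_fin => t_le0 t_ge0.
  have -> : t = 0 by apply/eqP; rewrite eq_le t_le0 t_ge0.
  by rewrite mulr0 oppr0 expR0 mul1r price_le0// intrinsic_le_put.
pose f (w : R * R) := (Num.max (K - Num.max w.1 0) 0)%:E.
have mf : measurable_fun setT f.
  apply/measurable_EFinP.
  exact: (measurableT_comp (measurable_put0 K) measurable_fst).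
have f0 w : (0 <= f w)%E by rewrite lee_fin le_max lexx orbT.
apply: (@le_trans _ _ (\int[Pr]_w f w)%E); last first.
  rewrite (fubini_tonelli1 _ mf f0) -put_mu.
  apply: ge0_le_integral_nonmeasurable => x.
    by apply: integral_ge0 => u _; exact: f0.
  have -> : fubini_F nu f x = (\int[nu]_u cst (f (x, 0%R)) u)%E by [].
  by rewrite integral_cst//= probability_setT mule1.
apply: ge0_le_integral_nonmeasurable => w; rewrite lee_fin//.
rewrite /put_payoff; case E : (tau w) => [t| |]; [|by rewrite le_max lexx orbT..].
have t0 : 0 < t.
  rewrite ltNge; apply/negP => t_le0.
  have : [set w | (tau w <= 0%:E)%E] w by rewrite /= E lee_fin.
  by rewrite tau_gt0.
have e1 : expR (- (r * t)) <= 1.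
  by rewrite -expR0 ler_expR oppr_le0 mulr_ge0 ?ltW.
apply: (@le_trans _ _ (Num.max (K - price t w) 0)).
  by rewrite ler_piMl// le_max lexx orbT.
rewrite ge_max !le_max lexx orbT andbT lerD2l lerN2 price_gt0//.
by rewrite grow_ge// ltW.
Qed.

(* Jensen's inequality, obtained by integrating [c <= (c - y)^+ + y]. *)
Lemma put_le_integral_dgrow c t x : 0 <= t ->
  ((Num.max (c - Num.max x 0) 0)%:E <= \int[nu]_u (Num.max (c - dgrow t x u) 0)%:E)%E.
Proof.
move=> t0; rewrite EFin_max ge_max; apply/andP; split; last first.
  by apply: integral_ge0 => u _; rewrite lee_fin le_max lexx orbT.
rewrite EFinB leeBlDr// -(integral_dgrow x t0).
have mM : measurable_fun setT (dgrow t x) by exact: measurable_dgrowx.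
rewrite -ge0_integralD//; last 4 first.
- by move=> u _; rewrite lee_fin le_max lexx orbT.
- by apply/measurable_EFinP; exact: (measurableT_comp (measurable_put c) mM).
- by move=> u _; rewrite lee_fin dgrow_ge0.
- by apply/measurable_EFinP.
have [c0|c0] := leP 0 c; last first.
  apply: (@le_trans _ _ 0%E); first by rewrite lee_fin ltW.
  apply: integral_ge0 => u _; rewrite adde_ge0// lee_fin ?dgrow_ge0//.
  by rewrite le_max lexx orbT.
apply: (@le_trans _ _ (\int[nu]_u cst c%:E u)%E).
  by rewrite integral_cst//= probability_setT mule1.
apply: ge0_le_integral_nonmeasurable => u; first by rewrite lee_fin.
by rewrite -EFinD lee_fin -lerBlDr le_max lexx.
Qed.

(** Discounting replaces the strike by [c = expR (- (r * t)) * K]. Jensen's inequality brings the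
    payoff back to the initial level, and lowering the strike to [c] costs at most
    [K - c <= K * (r * t)]. *)
Lemma put_le_expectation t : 0 < t ->
  (p%:E <= 'E_Pr[put_payoff r K price (cst t%:E)] + (K * (r * t))%:E)%E.
Proof.
move=> t0; pose c := expR (- (r * t)) * K; rewrite unlock.
have payoffE w : put_payoff r K price (cst t%:E) w = Num.max (c - dgrow t w.1 w.2) 0.
  by rewrite /put_payoff/= maxr_pMr ?expR_ge0// mulr0 mulrBr price_gt0.
have cK : K <= c + K * (r * t).
  rewrite /c mulrC -mulrDr; apply: ler_peMr; first exact: ltW.
  by rewrite -lerBlDr (le_trans _ (expR_ge1Dx _)).
rewrite (_ : integral _ _ _ = \int[Pr]_w (Num.max (c - dgrow t w.1 w.2) 0)%:E)%E; last first.
  by apply: eq_integral => w _; rewrite payoffE.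
rewrite fubini_tonelli1; last 2 first.
- apply/measurable_EFinP.
  exact: (measurableT_comp (measurable_put c) (measurable_dgrow _)).
- by move=> w; rewrite lee_fin le_max lexx orbT.
have rt0 : 0 <= K * (r * t) by rewrite !mulr_ge0// ltW.
apply: (@le_trans _ _ (\int[mu]_x (Num.max (c - Num.max x 0) 0)%:E + (K * (r * t))%:E)%E); last first.
  rewrite leeD2r//; apply: ge0_le_integral_nonmeasurable => x.
    by rewrite lee_fin le_max lexx orbT.
  exact: put_le_integral_dgrow (ltW t0).
have -> : ((K * (r * t))%:E = \int[mu]_x cst (K * (r * t))%:E x)%E.
  by rewrite integral_cst//= probability_setT mule1.
rewrite -ge0_integralD//; last 2 first.
- by move=> x _; rewrite lee_fin le_max lexx orbT.
- by apply/measurable_EFinP.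
rewrite -put_mu; apply: ge0_le_integral_nonmeasurable => x.
  by rewrite lee_fin le_max lexx orbT.
rewrite -EFinD lee_fin ge_max; apply/andP; split.
  rewrite -lerBlDr le_max; apply/orP; left.
  by rewrite lerBlDr addrAC lerD2r.
by rewrite addr_ge0// le_max lexx orbT.
Qed.

Lemma ereal_sup_put :
  ereal_sup [set 'E_Pr[put_payoff r K price tau] | tau in stopping_time price_filtration]%E = p%:E.
Proof.
apply/eqP; rewrite eq_le; apply/andP; split.
  by apply: ge_ereal_sup => _ [tau tauF <-]; exact: expectation_put_le.
apply/lee_addgt0Pr => e e0.
(* Chosen so that the loss [K * (r * t)] of exercising at [t] is exactly [e]. *)
pose t := e / (K * r).
have t0 : 0 < t by rewrite divr_gt0// mulr_gt0.
have -> : e = K * (r * t) by rewrite mulrA mulrC divfK// gt_eqF// mulr_gt0.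
apply: le_trans (put_le_expectation t0) _; rewrite leeD2r//.
apply: ereal_sup_ubound; exists (cst t%:E) => //; split => [w|s s0].
  by rewrite lee_fin ltW.
apply: price_filtration_trivial.
have [ts|ts] := leP t s; [right|left]; apply/seteqP; split => w //=.
by rewrite lee_fin leNgt ts.
Qed.

End put.

End growth.

(** * Convex put prices as expectations *)

Lemma exists_probability_cdf (R : realType) (F : R -> R) :
  nondecreasing F -> right_continuous F -> F @ -oo --> (0 : R) -> F @ +oo --> (1 : R) ->
  exists mu : probability R R, forall k, mu `]-oo, k]%classic = (F k)%:E.
Proof.
move=> Fnd Frc F0 F1.
pose f : cumulativeBounded (0 : R) 1 :=
  HB.pack F (isCumulative.Build R _ R F Fnd Frc) (isCumulativeBounded.Build R 0 1 F F0 F1).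
exists (on_real (lebesgue_stieltjes_measure f)) => k.
rewrite -[F k]/(f k) -cdf_lebesgue_stieltjes_id.
by [].
Qed.

(* Cutting [a, b] into [n] equal pieces and telescoping gives
   [`|D b - D a| <= (F b - F a) * (b - a) / n]. *)
Lemma eq_of_increment (R : realType) (D F : R -> R) (a b : R) : 0 < a -> a <= b ->
  (forall s t, 0 < s -> s <= t -> `|D t - D s| <= (F t - F s) * (t - s)) -> D a = D b.
Proof.
move=> a0 ab DF.
have step (h : R) n : 0 <= h -> `|D (a + h *+ n) - D a| <= (F (a + h *+ n) - F a) * h.
  move=> h0; elim: n => [|n IH]; first by rewrite mulr0n addr0 !subrr normr0 mul0r.
  have -> : D (a + h *+ n.+1) - D a =
      (D (a + h *+ n.+1) - D (a + h *+ n)) + (D (a + h *+ n) - D a) by ring.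
  rewrite (le_trans (ler_normD _ _))//.
  have -> : (F (a + h *+ n.+1) - F a) * h =
      (F (a + h *+ n.+1) - F (a + h *+ n)) * h + (F (a + h *+ n) - F a) * h by ring.
  rewrite lerD// (le_trans (DF _ _ _ _))//.
  - by rewrite (lt_le_trans a0)// lerDl mulrn_wge0.
  - by rewrite lerD2l mulrS lerDr.
  - by rewrite mulrS [X in _ * X](_ : _ = h)//; ring.
pose c := (F b - F a) * (b - a).
have bound n : `|D b - D a| *+ n.+1 <= c.
  have h0 : 0 <= (b - a) / n.+1%:R by rewrite divr_ge0// subr_ge0.
  have hn : a + (b - a) / n.+1%:R *+ n.+1 = b.
    by rewrite -mulr_natr divfK// addrC subrK.
  have := step _ n.+1 h0; rewrite hn mulrA ler_pdivlMr// mulr_natr.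
  exact.
apply/eqP; rewrite eq_sym -subr_eq0 -normr_eq0 eq_le normr_ge0 andbT leNgt.
apply/negP => D0.
have c0 : 0 <= c by rewrite (le_trans _ (bound 0%N)).
have := archi_boundP (divr_ge0 c0 (ltW D0)); move: (Num.bound _) => n.
rewrite ltr_pdivrMr// mulr_natl ltNge => /negP; apply.
apply: le_trans (bound n).
by rewrite mulrSr lerDl ltW.
Qed.

(** * The right derivative of a convex price function *)

Section slopes.
Variables (R : realType) (P : R -> R).
Hypothesis hconvex : convex_function (`]0, +oo[%classic : set R) P.

Lemma convex_three_slopes (x y z : R) : 0 < x -> x < y -> y < z ->
  (P y - P x) * (z - y) <= (P z - P y) * (y - x).
Proof.
move=> x0 xy yz; have xz := lt_trans xy yz.
have zx0 : 0 < z - x by rewrite subr_gt0.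
have t0 : 0 <= (z - y) / (z - x) by rewrite divr_ge0 ?subr_ge0// ltW.
have t1 : (z - y) / (z - x) <= 1.
  by rewrite ler_pdivrMr// mul1r lerB// ltW.
pose t : {i01 R} := Itv01 t0 t1.
have xin : x \in (`]0, +oo[%classic : set R) by rewrite inE/= in_itv/= x0.
have zin : z \in (`]0, +oo[%classic : set R).
  by rewrite inE/= in_itv/= (lt_trans x0 xz).
have := hconvex t xin zin; rewrite [leRHS]convRE [X in P X]convRE /= /unstable.onem.
set q := (z - y) / (z - x).
have -> : q * x + (1 - q) * z = y by rewrite /q; field; rewrite gt_eqF.
rewrite -(ler_pM2r zx0) -subr_ge0 => H; rewrite -subr_ge0.
rewrite [leRHS](_ : _ = (q * P x + (1 - q) * P z) * (z - x) - P y * (z - x))//.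
have -> : (q * P x + (1 - q) * P z) * (z - x) = (z - y) * P x + (y - x) * P z.
  by rewrite /q; field; rewrite gt_eqF.
ring.
Qed.

Definition slope (a b : R) := (P b - P a) / (b - a).

Lemma slope_le a b c d : 0 < a -> a < b -> b <= c -> c < d -> slope a b <= slope c d.
Proof.
have adj x y z : 0 < x -> x < y -> y < z -> slope x y <= slope y z.
  move=> x0 xy yz; rewrite /slope ler_pdivrMr ?subr_gt0// mulrAC.
  by rewrite ler_pdivlMr ?subr_gt0// convex_three_slopes.
move=> a0 ab; rewrite le_eqVlt => /predU1P[<-|bc] cd; first exact: adj.
apply: (@le_trans _ _ (slope b c)); first exact: adj.
by apply: adj => //; exact: lt_trans ab.
Qed.

Definition right_slopes (k : R) : set R :=
  [set q | exists a b, [/\ 0 < a, k < a, a < b & q = slope a b]].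

(* The right derivative of [P], extended by [0]; slopes starting strictly to the
   right of [k] make right-continuity immediate. *)
Definition slope_cdf (k : R) : R := if k < 0 then 0 else inf (right_slopes k).

Hypothesis hmono : forall K L : R, 0 < K -> K <= L -> P K <= P L.

Lemma slope_ge0 a b : 0 < a -> a < b -> 0 <= slope a b.
Proof.
by move=> a0 ab; rewrite /slope divr_ge0 ?subr_ge0 ?hmono// ltW.
Qed.

Lemma right_slopes_nonempty k : right_slopes k !=set0.
Proof.
have M0 : 0 < Num.max k 0 + 1 by rewrite ltr_wpDl// le_max lexx orbT.
exists (slope (Num.max k 0 + 1) (Num.max k 0 + 2)), (Num.max k 0 + 1), (Num.max k 0 + 2).
split=> //; last by rewrite ltrD2l ltr1n.
by rewrite ltr_pwDr// le_max lexx.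
Qed.

Lemma right_slopes_lbound k : lbound (right_slopes k) 0.
Proof. by move=> _ [a [b [a0 _ ab ->]]]; exact: slope_ge0. Qed.

Lemma has_inf_right_slopes k : has_inf (right_slopes k).
Proof.
by split; [exact: right_slopes_nonempty|exists 0; exact: right_slopes_lbound].
Qed.

Lemma slope_cdf_le k a b : 0 < a -> k < a -> a < b -> slope_cdf k <= slope a b.
Proof.
move=> a0 ka ab; rewrite /slope_cdf; case: ifPn => _; first exact: slope_ge0.
by apply: ge_inf; [exists 0; exact: right_slopes_lbound|exists a, b].
Qed.

Lemma slope_cdf_nondecreasing : nondecreasing slope_cdf.
Proof.
move=> k l kl; rewrite {2}/slope_cdf; case: ifPn => [l0|].
  by rewrite /slope_cdf (le_lt_trans kl l0).
rewrite -leNgt => l0; apply: lb_le_inf; first exact: right_slopes_nonempty.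
by move=> _ [a [b [a0 la ab ->]]]; apply: slope_cdf_le => //; exact: le_lt_trans la.
Qed.

Lemma slope_cdf_right_continuous : right_continuous slope_cdf.
Proof.
move=> k; apply/cvgrPdist_le => e e0; have [k0|k0] := ltP k 0.
  near=> y; have y0 : y < 0 by near: y; exact: nbhs_right_lt.
  by rewrite /slope_cdf k0 y0 subrr normr0 ltW.
have [q [a [b [a0 ka ab ->]]]] := inf_adherent e0 (has_inf_right_slopes k).
move=> qe; near=> y.
have ky : k < y by near: y; exact: nbhs_right_gt.
have ya : y < a by near: y; exact: nbhs_right_lt.
rewrite distrC ger0_norm ?subr_ge0 ?slope_cdf_nondecreasing ?(ltW ky)//.
rewrite lerBlDl (le_trans (slope_cdf_le a0 ya ab))//.
by rewrite (le_trans (ltW qe))// /slope_cdf ltNge k0.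
Unshelve. all: by end_near. Qed.

Variables (x0 Ks : R).
Hypotheses (x00 : 0 < x0) (x0Ks : x0 < Ks).
Hypothesis hlarge : forall K, Ks <= K -> P K = K - x0.

(** Past [Ks] the function [P] is affine with slope 1, which fixes the total mass and confines the
    law to []-oo, Ks]]. *)
Lemma slope_cdf1 k : Ks <= k -> slope_cdf k = 1.
Proof.
move=> Kk; have k0 : 0 < k by rewrite (lt_le_trans _ Kk)// (lt_trans x00).
rewrite /slope_cdf ltNge ltW//= (_ : right_slopes k = [set 1]) ?inf1//.
have s1 a b : k < a -> a < b -> slope a b = 1.
  move=> ka ab; rewrite /slope !hlarge ?(le_trans Kk) ?ltW// ?(lt_trans ka)//.
  have -> : b - x0 - (a - x0) = b - a by ring.
  by rewrite divff// subr_eq0 gt_eqF.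
apply/seteqP; split=> [_ [a [b [a0 ka ab ->]]]|_ ->]; first exact: s1.
exists (k + 1), (k + 2); rewrite s1 ?ltrD2l ?ltr1n ?ltrDl//.
by split=> //; rewrite ?ltrD2l ?ltr1n ?ltrDl// addr_gt0.
Qed.

Lemma slope_cdf_le1 k : slope_cdf k <= 1.
Proof.
rewrite -(@slope_cdf1 (Num.max k Ks)) ?le_max ?lexx ?orbT//.
by apply: slope_cdf_nondecreasing; rewrite le_max lexx.
Qed.

(** [slope_cdf a] is compared only with slopes that start strictly after [a]. Starting at a nearby
    [a'] loses at most [slope_cdf a * (a' - a) <= e], because [slope_cdf] is at most 1. *)
Lemma slope_cdf_lower a b : 0 < a -> a <= b -> slope_cdf a * (b - a) <= P b - P a.
Proof.
move=> a0; rewrite le_eqVlt => /predU1P[->|ab]; first by rewrite !subrr mulr0.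
apply/ler_addgt0Pr => e e0.
pose a' := Num.min ((a + b) / 2) (a + e).
have aa' : a < a' by rewrite /a' lt_min ltrDl e0 andbT midf_lt.
have a'b : a' < b by rewrite /a' gt_min midf_lt.
have a'e : a' - a <= e by rewrite lerBlDl /a' ge_min lexx orbT.
have := slope_cdf_le (lt_trans a0 aa') aa' a'b.
rewrite /slope ler_pdivlMr ?subr_gt0// => H.
have H2 : P a <= P a' by rewrite hmono// ltW.
have H3 : slope_cdf a * (a' - a) <= e.
  by rewrite (le_trans _ a'e)// ler_piMl ?slope_cdf_le1// subr_ge0 ltW.
have -> : slope_cdf a * (b - a) = slope_cdf a * (b - a') + slope_cdf a * (a' - a) by ring.
by rewrite lerD// (le_trans H)// lerD2l lerN2.
Qed.

(** By convexity the slope from [a] to [b] is a lower bound of all slopes starting after [b], hence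
    of their infimum. *)
Lemma slope_cdf_upper a b : 0 < a -> a <= b -> P b - P a <= slope_cdf b * (b - a).
Proof.
move=> a0; rewrite le_eqVlt => /predU1P[->|ab]; first by rewrite !subrr mulr0.
rewrite -ler_pdivrMr ?subr_gt0// -/(slope a b) /slope_cdf ltNge (ltW (lt_trans a0 ab))/=.
apply: lb_le_inf; first exact: right_slopes_nonempty.
by move=> _ [c [d [c0 bc cd ->]]]; apply: slope_le => //; exact: ltW.
Qed.

Lemma exists_slope_law : exists mu : probability R R, forall k, mu `]-oo, k]%classic = (slope_cdf k)%:E.
Proof.
apply: exists_probability_cdf.
- exact: slope_cdf_nondecreasing.
- exact: slope_cdf_right_continuous.
- apply: (@cvg_trans _ (cst 0 @ -oo)); last exact: cvg_cst.
  apply: near_eq_cvg; near=> k; rewrite /slope_cdf.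
  by have -> : k < 0 by near: k; exact: nbhs_ninfty_lt.
- apply: (@cvg_trans _ (cst 1 @ +oo)); last exact: cvg_cst.
  apply: near_eq_cvg; by near=> k; rewrite slope_cdf1.
Unshelve. all: by end_near. Qed.

End slopes.

(** * Recovering put prices from the distribution function *)

Section law_of_put_prices.
Variables (R : realType) (mu : probability R R) (F : R -> R).
Hypothesis muF : forall k, mu `]-oo, k]%classic = (F k)%:E.

Definition put (x : R) (k : R) : R := Num.max (k - Num.max x 0) 0.

Lemma put_ge0 x k : 0 <= put x k.
Proof. by rewrite le_max lexx orbT. Qed.

Lemma put_le x k : 0 < k -> put x k <= k.
Proof. by move=> k0; rewrite ge_max (ltW k0) andbT gerBl le_max lexx orbT. Qed.

Lemma measurable_put k : measurable_fun setT (put ^~ k).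
Proof.
apply: measurable_maxr => //; apply: measurable_funB => //.
exact: measurable_maxr.
Qed.

Definition integral_put (k : R) : \bar R := (\int[mu]_x (put x k)%:E)%E.

Lemma integral_put_bounds k : 0 < k -> (0 <= integral_put k <= k%:E)%E.
Proof.
move=> k0; apply/andP; split.
  by apply: integral_ge0 => x _; rewrite lee_fin put_ge0.
have -> : k%:E = (\int[mu]_x cst k%:E x)%E.
  by rewrite integral_cst//= probability_setT mule1.
by apply: ge0_le_integral_nonmeasurable => x; rewrite lee_fin ?put_ge0 ?put_le.
Qed.

Lemma integral_put_fin k : 0 < k -> integral_put k \is a fin_num.
Proof.
move=> /integral_put_bounds/andP[g0 gk].
by rewrite ge0_fin_numE// (le_lt_trans gk)// ltry.
Qed.

Lemma integral_indic_cdf k c : 0 <= c ->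
  (\int[mu]_x (c * \1_(`]-oo, k]%classic : set R) x)%:E = (c * F k)%:E)%E.
Proof.
move=> c0; transitivity (\int[mu]_x (c%:E * (\1_(`]-oo, k]%classic : set R) x : R)%:E))%E.
  by apply: eq_integral => x _; rewrite EFinM.
rewrite ge0_integralZl//; last by apply/measurable_EFinP/measurable_indic.
by rewrite integral_indic// setIT EFinM; congr (_ * _)%E; exact: muF.
Qed.

Lemma measurable_cdf_indic (k c : R) :
  measurable_fun setT (fun x : R => c * \1_(`]-oo, k]%classic : set R) x : R).
Proof. by apply: measurable_funM => //; exact: measurable_indic. Qed.

(** Raising the strike from [a] to [b] raises the payoff by exactly [b - a] wherever [x <= a], and
    nowhere lowers it. *)
Lemma integral_put_lower a b : 0 < a -> a <= b ->
  (integral_put a + (F a * (b - a))%:E <= integral_put b)%E.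
Proof.
move=> a0 ab; have ba0 : 0 <= b - a by rewrite subr_ge0.
rewrite mulrC -integral_indic_cdf// /integral_put -ge0_integralD//; last 4 first.
- by move=> x _; rewrite lee_fin put_ge0.
- by apply/measurable_EFinP; exact: measurable_put.
- by move=> x _; rewrite lee_fin mulr_ge0.
- by apply/measurable_EFinP; exact: measurable_cdf_indic.
apply: ge0_le_integral_nonmeasurable => x.
  by rewrite -EFinD lee_fin addr_ge0 ?put_ge0 ?mulr_ge0.
rewrite -EFinD lee_fin /put indicE; have [xa|ax] := leP x a.
  rewrite mem_set ?mulr1/=; last by rewrite in_itv.
  have xp : Num.max x 0 <= a by rewrite ge_max xa ltW.
  move: (Num.max x 0) xp => y ya.
  rewrite !max_l ?subr_ge0 ?(le_trans ya)//; lra.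
rewrite memNset ?mulr0 ?addr0/=; last by rewrite in_itv/=; apply/negP; rewrite -ltNge.
by rewrite ge_max !le_max lexx orbT lerD2r ab.
Qed.

(** The payoff rises by at most [b - a], and it vanishes at both strikes when [x > b]. *)
Lemma integral_put_upper a b : 0 < a -> a <= b ->
  (integral_put b <= integral_put a + (F b * (b - a))%:E)%E.
Proof.
move=> a0 ab; have ba0 : 0 <= b - a by rewrite subr_ge0.
rewrite mulrC -integral_indic_cdf// /integral_put -ge0_integralD//; last 4 first.
- by move=> x _; rewrite lee_fin put_ge0.
- by apply/measurable_EFinP; exact: measurable_put.
- by move=> x _; rewrite lee_fin mulr_ge0.
- by apply/measurable_EFinP; exact: measurable_cdf_indic.
apply: ge0_le_integral_nonmeasurable => x; first by rewrite lee_fin put_ge0.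
rewrite -EFinD lee_fin indicE; have [xb|bx] := leP x b.
  rewrite mem_set ?mulr1/=; last by rewrite in_itv.
  rewrite /put ge_max addr_ge0 ?le_max ?lexx ?orbT// andbT.
  by rewrite -lerBlDr le_max; apply/orP; left; lra.
rewrite {1}/put max_r; last first.
  by rewrite subr_le0 le_max (ltW bx).
by rewrite addr_ge0 ?put_ge0 ?mulr_ge0.
Qed.

Variables (P : R -> R).
Hypothesis PF_lower : forall a b, 0 < a -> a <= b -> F a * (b - a) <= P b - P a.
Hypothesis PF_upper : forall a b, 0 < a -> a <= b -> P b - P a <= F b * (b - a).
Hypothesis P_bounds : forall k, 0 < k -> 0 <= P k <= k.

(** The increments of [P] and of the integrated put both lie between [F a * (b - a)] and
    [F b * (b - a)], so [eq_of_increment] makes their difference constant on []0, +oo[]. Both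
    functions lie between 0 and the strike, so this constant is seen to be 0 near 0. *)
Lemma integral_putE k : 0 < k -> integral_put k = (P k)%:E.
Proof.
move=> k0; pose G k := fine (integral_put k).
have GE a : 0 < a -> integral_put a = (G a)%:E.
  by move=> a0; rewrite /G fineK// integral_put_fin.
have G_bounds a : 0 < a -> 0 <= G a <= a.
  by move=> a0; have := integral_put_bounds a0; rewrite GE// !lee_fin.
pose D a := P a - G a.
have DF s t : 0 < s -> s <= t -> `|D t - D s| <= (F t - F s) * (t - s).
  move=> s0 st; have t0 := lt_le_trans s0 st.
  have := integral_put_lower s0 st; have := integral_put_upper s0 st.
  rewrite !GE// -!EFinD !lee_fin.
  have := PF_lower s0 st; have := PF_upper s0 st.
  rewrite /D mulrBl ler_norml.
  move: (F s * _) (F t * _) => y z; lra.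
have Dsmall e : 0 < e -> `|D k| <= e.
  move=> e0; pose m := Num.min e k.
  have m0 : 0 < m by rewrite lt_min e0.
  have mk : m <= k by rewrite ge_min lexx orbT.
  have me : m <= e by rewrite ge_min lexx.
  rewrite -(eq_of_increment m0 mk DF) /D ler_norml.
  have := G_bounds _ m0; have := P_bounds m0; lra.
rewrite GE//; congr EFin; apply/esym/eqP; rewrite -subr_eq0 -normr_le0 -/(D k).
by apply/ler_addgt0Pr => e e0; rewrite add0r Dsmall.
Qed.

(** When [F k = 1], almost every [x] is at most [k], and there the positive part and the put payoff
    add up to [k]. *)
Lemma mean_of_put k : 0 < k -> F k = 1 ->
  (\int[mu]_x (Num.max x 0)%:E = (k - P k)%:E)%E.
Proof.
move=> k0 Fk.
have mm : measurable_fun setT (fun x : R => Num.max x 0) by exact: measurable_maxr.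
suff H : (\int[mu]_x (Num.max x 0)%:E + integral_put k = k%:E)%E.
  by rewrite EFinB -H integral_putE// addeK.
rewrite /integral_put -ge0_integralD//; last 4 first.
- by move=> x _; rewrite lee_fin le_max lexx orbT.
- exact/measurable_EFinP.
- by move=> x _; rewrite lee_fin put_ge0.
- by apply/measurable_EFinP; exact: measurable_put.
have mup : mu `]k, +oo[%classic = 0%E.
  by rewrite -setCitvl probability_setC// muF Fk subee.
rewrite (@ge0_negligible_integral _ _ _ mu setT (`]k, +oo[%classic : set R))//=; last 2 first.
- apply: emeasurable_funD; apply/measurable_EFinP => //.
  exact: measurable_put.
- by move=> x _; rewrite -EFinD lee_fin addr_ge0 ?put_ge0// le_max lexx orbT.
rewrite setTD setCitvr.
transitivity (\int[mu]_(x in `]-oo, k]) cst k%:E x)%E.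
  apply: eq_integral => x /set_mem/=; rewrite in_itv/= => xk.
  have xp : Num.max x 0 <= k by rewrite ge_max xk ltW.
  rewrite /put.
  move: (Num.max x 0) xp => y yk.
  by rewrite max_l ?subr_ge0// -EFinD addrC subrK.
by rewrite integral_cst// [X in (_ * X)%E]muF Fk mule1.
Qed.

End law_of_put_prices.

Theorem theorem4p2 (R : realType) (r x0 : R) (P : R -> R)
  (hr : 0 < r) (hx0 : 0 < x0)
  (hbounds : forall K : R, 0 < K -> Num.max (K - x0) 0 <= P K /\ P K <= K)
  (hmono : forall K L : R, 0 < K -> K <= L -> P K <= P L)
  (hconvex : convex_function (`]0, +oo[%classic : set R) P)
  (hKstar : exists Kstar : R,
     [/\ x0 < Kstar,
         forall K : R, Kstar <= K -> P K = K - x0 &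
         forall K : R, x0 <= K -> K < Kstar -> K - x0 < P K]) :
  exists (d : measure_display) (T : measurableType d) (Pr : probability T R)
         (F : R -> set (set T)) (X : R -> T -> R),
    is_filtration F /\
    time_homogeneous_markov Pr F X /\
    (forall w (t : R), 0 < t -> X ^~ w @ at_right t --> X t w) /\
    (forall w, X 0 w = x0) /\
    (forall K : R, 0 < K ->
       ereal_sup [set 'E_Pr[put_payoff r K X tau] | tau in stopping_time F]%E
       = (P K)%:E) /\
    local_martingale Pr F (fun t w => expR (- (r * t)) * X t w).
Proof.
have [Ks [x0Ks hlarge _]] := hKstar.
have P_bounds K : 0 < K -> 0 <= P K <= K.
  move=> K0; have [Pge Ple] := hbounds _ K0.
  by rewrite Ple (le_trans _ Pge)// le_max lexx orbT.
have [mu muF] := exists_slope_law hmono hx0 x0Ks hlarge.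
have Flow := slope_cdf_lower hmono hx0 x0Ks hlarge.
have Fup := slope_cdf_upper hconvex.
have Ks0 : 0 < Ks := lt_trans hx0 x0Ks.
have put_mu K : 0 < K -> (\int[mu]_x (Num.max (K - Num.max x 0) 0)%:E = (P K)%:E)%E.
  exact: (integral_putE muF Flow Fup P_bounds).
have mean_mu : (\int[mu]_x (Num.max x 0)%:E = x0%:E)%E.
  (* At the strike [Ks] the mean is [Ks - P Ks = x0]: the initial jump preserves the mean. *)
  rewrite (mean_of_put muF Flow Fup P_bounds Ks0); last exact: (slope_cdf1 hx0 x0Ks hlarge).
  by rewrite hlarge// subKr.
exists _, (R * R)%type, (mu \x unif R)%E, (price_filtration r x0), (price r x0).
split; first exact: is_filtration_price.
split; first exact: time_homogeneous_markov_price.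
split; first by move=> w t; exact: right_continuous_price.
split; first by move=> w; rewrite price_le0.
split; first by move=> K K0; exact: (ereal_sup_put hr hx0 mean_mu K0 (put_mu _ K0)).
exact: (local_martingale_dprice hr hx0 mean_mu).
Qed.
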